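(* Let $v:\widehat{\mathcal C}\to\mathbb R$ be a bounded function and let $\lambda\in(1,\infty)$. If $$E\big[v(\widehat{\boldsymbol f}(\boldsymbol x,\boldsymbol u))\big]-\lambda\, v(\boldsymbol x)\ \ge\ 0\qquad\text{for all }\boldsymbol x\in\widehat{\mathcal C}\setminus\mathcal X_r,$$ then $\Omega=\{\boldsymbol x\in\mathcal C\mid v(\boldsymbol x)>0\}$ is an inner-approximation of the controlled reach-avoid set $\mathcal R$, i.e. $\{\boldsymbol x\in\mathcal C\mid v(\boldsymbol x)>0\}\subseteq\mathcal R$.
   Context: Consider the discrete-time control system $\boldsymbol x(k+1)=\boldsymbol f(\boldsymbol x(k),\boldsymbol u(k))$, $k\in\mathbb N=\{0,1,2,\dots\}$, with states in $\mathcal D\subseteq\mathbb R^n$, control inputs $\boldsymbol u(k)\in\mathcal U\subseteq\mathbb R^m$, and $\boldsymbol f:\mathbb R^n\times\mathbb R^m\to\mathbb R^n$ continuous. A controller is a sequence $\pi=(\boldsymbol u(l))_{l\in\mathbb N}$ with $\boldsymbol u(l)\in\mathcal U$ for all $l$; $\mathbb U$ is the set of all controllers. The trajectory $(\boldsymbol\phi_{\boldsymbol x_0}^{\pi}(l))_{l\in\mathbb N}$ induced by $\boldsymbol x_0\in\mathbb R^n$ and $\pi$ is given by $\boldsymbol\phi_{\boldsymbol x_0}^{\pi}(0)=\boldsymbol x_0$ and $\boldsymbol\phi_{\boldsymbol x_0}^{\pi}(l+1)=\boldsymbol f(\boldsymbol\phi_{\boldsymbol x_0}^{\pi}(l),\boldsymbol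 u(l))$. Let $\mathcal X_r\subseteq\mathbb R^n$ be a target set and $\mathcal C\subseteq\mathcal D$ a safe set. The controlled reach-avoid set is $$\mathcal R=\Big\{\boldsymbol x_0\in\mathcal C\ \Big|\ \exists \pi\in\mathbb U\ \exists k\in\mathbb N:\ \boldsymbol\phi_{\boldsymbol x_0}^{\pi}(k)\in\mathcal X_r\ \text{and}\ \boldsymbol\phi_{\boldsymbol x_0}^{\pi}(l)\in\mathcal C\ \text{for all } 0\le l\le k\Big\}.$$ The set $\mathcal U$ is endowed with an arbitrary but fixed probability measure $P$ (so $P(\mathcal U)=1$), and $E[\cdot]$ denotes expectation with respect to $\boldsymbol u\sim P$. $\widehat{\mathcal C}\subseteq\mathbb R^n$ is a set satisfying $$\widehat{\mathcal C}\supseteq\{\boldsymbol f(\boldsymbol x_0,\boldsymbol u)\mid \boldsymbol x_0\in\mathcal C,\ \boldsymbol u\in\mathcal U\}\cup\mathcal C.$$ With $1_{\mathcal A}$ denoting the indicator function of $\mathcal A$ (equal to $1$ on $\mathcal A$ and $0$ otherwise), $\widehat{\boldsymbol f}$ is defined for $\boldsymbol x\in\widehat{\mathcal C}$, $\boldsymbol u\in\mathcal U$ by $$\widehat{\boldsymbol f}(\boldsymbol x,\boldsymbol u)=1_{\mathcal C\setminus\mathcal X_r}(\boldsymbol x)\cdot\boldsymbol f(\boldsymbol x,\boldsymbol u)+1_{\mathcal X_r}(\boldsymbol x)\cdot\boldsymbol x+1_{\widehat{\mathcal C}\setminus\mathcal C}(\boldsymbol x)\cdot\boldsymbol x .$$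
   Formalization: The formal theorem additionally assumes that every target state lying in Ĉ is safe (Ĉ ∩ X_r ⊆ C, implied by X_r ⊆ C); without it the claim fails, e.g. f ≡ 1, C = {0}, X_r = {1}, Ĉ = {0,1}, v(0) = 1, v(1) = 2, λ = 2. *)

(* Defs.v *)
From HB Require Import structures.
From mathcomp Require Import all_boot all_order all_algebra.
From mathcomp Require Import all_classical all_reals all_analysis.

Set Implicit Arguments.
Unset Strict Implicit.
Unset Printing Implicit Defensive.

Import Order.TTheory GRing.Theory Num.Theory.
Import numFieldNormedType.Exports.

Local Open Scope classical_set_scope.
Local Open Scope ring_scope.

Section control_system.
Context {R : realType} {n m : nat}.
Implicit Types (f : 'rV[R]_n * 'rV[R]_m -> 'rV[R]_n) (U : set 'rV[R]_m).
Implicit Types (C Xr Chat : set 'rV[R]_n).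

Definition controllers U : set (nat -> 'rV[R]_m) :=
  [set pi | forall l, U (pi l)].

Fixpoint trajectory f (x0 : 'rV[R]_n) (pi : nat -> 'rV[R]_m) (l : nat)
    : 'rV[R]_n :=
  if l is l'.+1 then f (trajectory f x0 pi l', pi l') else x0.

Definition reach_avoid f U C Xr : set 'rV[R]_n :=
  [set x0 | C x0 /\
    exists2 pi, controllers U pi &
    exists k : nat, Xr (trajectory f x0 pi k) /\
      forall l, (l <= k)%N -> C (trajectory f x0 pi l)].

(* On [Chat] this is a definition by cases (the three indicated sets partition
   [Chat]) exactly when [Chat `&` Xr `<=` C]; otherwise the last two terms both count
   on [Chat `&` Xr `\` C]. *)
Definition fhat f C Xr Chat (x : 'rV[R]_n) (u : 'rV[R]_m) : 'rV[R]_n :=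
  \1_(C `\` Xr) x *: f (x, u) + \1_Xr x *: x + \1_(Chat `\` C) x *: x.

End control_system.

(* The set U itself, seen as a type, so that a probability measure can be put
   on it. Measurable types have to be pointed, whence the proof of nonemptiness,
   which is no restriction since P(U) = 1. *)
Definition input_space (R : realType) (m : nat) (U : set 'rV[R]_m)
  (U0 : U !=set0) : Type := set_type U.

HB.instance Definition _ (R : realType) (m : nat) (U : set 'rV[R]_m)
  (U0 : U !=set0) := Choice.copy (input_space U0) (set_type U).

Lemma input_point (R : realType) (m : nat) (U : set 'rV[R]_m)
  (U0 : U !=set0) : input_space U0.
Proof. by have [u Uu] := cid U0; exists u; rewrite inE. Qed.

HB.instance Definition _ (R : realType) (m : nat) (U : set 'rV[R]_m)
  (U0 : U !=set0) := isPointed.Build (input_space U0) (input_point U0).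

Definition input_val (R : realType) (m : nat) (U : set 'rV[R]_m)
  (U0 : U !=set0) (u : input_space U0) : 'rV[R]_m := \val (u : set_type U).

(* Main.v *)
Require Import Defs.
From mathcomp Require Import all_boot all_order all_algebra.
From mathcomp Require Import all_classical all_reals all_analysis.
From mathcomp Require Import lra.

Import Order.TTheory GRing.Theory Num.Theory.
Import numFieldNormedType.Exports.
Local Open Scope classical_set_scope.
Local Open Scope ring_scope.

(** A point of the safe set outside the target whose value is [v x > 0] has an
input leading to a state of value at least [v x + delta] for a fixed
[delta > 0], since otherwise the expectation would be below [lambda * v x].
That state cannot have left the safe set: there the modified dynamics are
frozen, so the hypothesis reads [v >= lambda * v] and forces [v <= 0]. As [v] is
bounded, finitely many such steps must end in the target. *)

(* The functions need not be measurable: the integral of a nonnegative function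
is a supremum over the simple functions below it. *)
Lemma le_integral_pointwise d (T : measurableType d) (R : realType)
    (mu : {measure set T -> \bar R}) (D : set T) (g h : T -> \bar R) :
  (forall x, D x -> (g x <= h x)%E) ->
  (\int[mu]_(x in D) g x <= \int[mu]_(x in D) h x)%E.
Proof.
have ge0_le (g' h' : T -> \bar R) : (forall x, D x -> (0 <= g' x)%E) ->
    (forall x, D x -> (g' x <= h' x)%E) ->
    (\int[mu]_(x in D) g' x <= \int[mu]_(x in D) h' x)%E.
  move=> g0 gh.
  have h0 x : D x -> (0 <= h' x)%E by move=> Dx; apply: le_trans (gh _ Dx); apply: g0.
  rewrite !ge0_integralE //; apply: ereal_sup_le.
  apply: image_subset => s /= sg x; apply: le_trans (sg x) _.
  by rewrite /patch; case: ifPn => // /set_mem /gh.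
(* Positive parts grow with the function while negative parts shrink, so the nonnegative case
   settles both. *)
move=> gh; rewrite integralE [leRHS]integralE; apply: leeB; apply: ge0_le => x Dx //.
  by rewrite !funeposE ge_max !le_max gh ?lexx ?orbT.
by rewrite !funenegE ge_max !le_max leeN2 gh ?lexx ?orbT.
Qed.

Lemma expectation_le_cst d (T : measurableType d) (R : realType)
    (P : probability T R) (X : T -> R) (c : R) :
  (forall w, X w <= c) -> ('E_P[X] <= c%:E)%E.
Proof.
move=> Xc; rewrite -(expectation_cst P c) unlock.
by apply: le_integral_pointwise => w _; rewrite lee_fin.
Qed.

Section control_system.
Context {R : realType} {n m : nat}.
Context {f : 'rV[R]_n * 'rV[R]_m -> 'rV[R]_n} {U : set 'rV[R]_m}.
Context {C Xr Chat : set 'rV[R]_n}.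

Lemma fhat_safe x u : C x -> ~ Xr x -> fhat f C Xr Chat x u = f (x, u).
Proof.
move=> Cx Xrx; rewrite /fhat !indicE mem_set// memNset// memNset; last by case.
by rewrite !scale0r !addr0 scale1r.
Qed.

Lemma fhat_unsafe x u : Chat x -> ~ C x -> ~ Xr x -> fhat f C Xr Chat x u = x.
Proof.
move=> Chx Cx Xrx; rewrite /fhat !indicE memNset; last by case.
by rewrite memNset// mem_set// !scale0r !add0r scale1r.
Qed.

Lemma reach_avoid_target x : U !=set0 -> C x -> Xr x -> reach_avoid f U C Xr x.
Proof.
move=> [u Uu] Cx Xrx; split=> //; exists (fun=> u) => //.
by exists 0%N; split=> // l; rewrite leqn0 => /eqP->.
Qed.

Lemma trajectory_cons x (pi : nat -> 'rV[R]_m) l :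
  trajectory f x pi l.+1 = trajectory f (f (x, pi 0%N)) (pi \o S) l.
Proof. by elim: l => //= l <-. Qed.

Lemma reach_avoid_step x u : C x -> U u ->
  reach_avoid f U C Xr (f (x, u)) -> reach_avoid f U C Xr x.
Proof.
move=> Cx Uu [_ [pi Upi [k [Xrk Ck]]]]; split=> //.
exists (fun l => if l is l'.+1 then pi l' else u); first by case.
by exists k.+1; rewrite trajectory_cons; split=> // -[|l] // lk;
  rewrite trajectory_cons; apply: Ck.
Qed.

End control_system.

Theorem theorem1 (R : realType) (n m : nat)
    (f : 'rV[R]_n * 'rV[R]_m -> 'rV[R]_n)
    (D C Xr Chat : set 'rV[R]_n) (U : set 'rV[R]_m)
    (f_cont : continuous f)
    (C_sub_D : C `<=` D)
    (Chat_sup : [set f (x0, u) | x0 in C & u in U] `|` C `<=` Chat)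
    (Chat_Xr_sub_C : Chat `&` Xr `<=` C)
    (U0 : U !=set0)
    (S : set (set (input_space U0)))
    (P : probability (g_sigma_algebraType S) R)
    (v : 'rV[R]_n -> R)
    (v_bounded : [bounded v x | x in Chat])
    (lambda : R) (lambda_gt1 : 1 < lambda)
    (v_expect : forall x, (Chat `\` Xr) x ->
      (0 <= 'E_P[fun u : input_space U0 => v (fhat f C Xr Chat x (input_val u))]
            - (lambda * v x)%:E)%E) :
  [set x | C x /\ 0 < v x] `<=` reach_avoid f U C Xr.
Proof.
have [M vM] : exists M, forall x, Chat x -> `|v x| <= M.
  by have [M _ vM] := pinfty_ex_gt0 v_bounded; exists M.
(* The expectation hypothesis enters only in this form: since [P] has mass 1, a bound valid for
   every input also bounds the mean. *)
have lambda_expect x c : (Chat `\` Xr) x ->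
    (forall u, U u -> v (fhat f C Xr Chat x u) <= c) -> lambda * v x <= c.
  move=> Chx vc; rewrite -lee_fin -sube_ge0 //.
  apply: le_trans (v_expect _ Chx) _; apply: leeD2r.
  by apply: expectation_le_cst => u; apply: vc; apply: set_valP.
have nonpos_unsafe x : Chat x -> ~ C x -> v x <= 0.
  move=> Chx Cx; have Xrx : ~ Xr x by move=> Xrx; apply/Cx/Chat_Xr_sub_C.
  have : lambda * v x <= v x.
    by apply: lambda_expect => // u _; rewrite fhat_unsafe.
  by rewrite -subr_ge0 -{1}[v x]mul1r -mulrBl nmulr_rge0 ?subr_lt0.
move=> x0 [Cx0 vx0].
(* When [v x0 <= v x], the guaranteed gain [(lambda - 1) * v x] is at least [2 * delta]. The factor
   1/2 leaves the strict gap that contradicts [lambda * v x <= v x + delta]. *)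
pose delta := (lambda - 1) / 2 * v x0.
have delta_gt0 : 0 < delta by rewrite !mulr_gt0 ?subr_gt0.
have increase x : C x -> ~ Xr x -> v x0 <= v x ->
    exists2 u, U u & v x + delta < v (f (x, u)).
  move=> Cx Xrx vx; apply: contrapT => no_u.
  have : lambda * v x <= v x + delta.
    apply: lambda_expect; first by split=> //; apply: Chat_sup; right.
    move=> u Uu; rewrite fhat_safe// leNgt; apply/negP => vu.
    by apply: no_u; exists u.
  by apply/negP; rewrite -ltNge /delta; nra.
(* [k] bounds the number of steps left: each one raises [v] by more than [delta], and at [k = 0] the
   bound [M] would be exceeded. *)
suff main k x : C x -> v x0 <= v x -> M < v x + k%:R * delta ->
    reach_avoid f U C Xr x.
  apply: (main (Num.bound `|(M - v x0) / delta|)) => //.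
  rewrite -ltrBlDl -ltr_pdivrMr //; apply: le_lt_trans (ler_norm _) _.
  by rewrite archi_boundP.
elim: k x => [|k IHk] x Cx vx Mx.
  have /vM/ler_normlW : Chat x by apply: Chat_sup; right.
  by rewrite leNgt; move: Mx; rewrite mul0r addr0 => ->.
have [Xrx|Xrx] := pselect (Xr x); first exact: reach_avoid_target.
have [u Uu vu] := increase _ Cx Xrx vx.
apply: (reach_avoid_step _ _ Cx Uu).
have Chf : Chat (f (x, u)) by apply: Chat_sup; left; exists x => //; exists u.
apply: IHk.
(* The new value exceeds [v x0 + delta], hence is positive, which is impossible outside [C]. *)
- by apply: contrapT => /(nonpos_unsafe _ Chf); lra.
- by lra.
- by move: Mx; rewrite -natr1; lra.
Qed.
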